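(* Let $u\in\Bbbk(x,y)\setminus\Bbbk$ be a non-constant rational function that possesses a polynomial generative function. Let $p\in\Bbbk[x,y]$ be an irreducible polynomial that is a generative function for $u$. Then: (1) for every nonzero element $f\delta_p$ of $\mathcal{A}_{W_2}(u)$ (with $f\in\Bbbk[x,y]$, $f\neq 0$), the centralizer of $f\delta_p$ in the Lie algebra $\mathcal{A}_{W_2}(u)$ equals $\bar f\,\Bbbk[p]\,\delta_p$, where $\bar f$ is a $p$-free polynomial corresponding to $f$; (2) the maximal abelian subalgebras of $\mathcal{A}_{W_2}(u)$ are precisely the subspaces of the form $\bar f\,\Bbbk[p]\,\delta_p$, where $\bar f$ is a $p$-free polynomial.
   Context: $\Bbbk$ is an algebraically closed field of characteristic zero. $W_2=W_2(\Bbbk)$ is the Lie algebra of all $\Bbbk$-derivations of $\Bbbk[x,y]$ with bracket $[D_1,D_2]=D_1D_2-D_2D_1$; each $D\in W_2$ extends uniquely to a derivation of $\Bbbk(x,y)$. For $u\in\Bbbk(x,y)\setminus\Bbbk$, the annihilator of $u$ is the Lie subalgebra $\mathcal{A}_{W_2}(u)=\{D\in W_2 : D(u)=0\}$ of $W_2$. A generative function of $u\in\Bbbk(x,y)\setminus\Bbbk$ is a generator (over $\Bbbk$) of the maximal subfield of $\Bbbk(x,y)$ of transcendence degree $1$ over $\Bbbk$ that contains $u$. If $u$ has a polynomial generative function, then it has an irreducible polynomial generative function. For an irreducible polynomial $p\in\Bbbk[x,y]$ let $h=\gcd\left(\frac{\partial p}{\partial x},\frac{\partial p}{\partial y}\right)$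 and $$\delta_p=\frac1h\left(-\frac{\partial p}{\partial y}\frac{\partial}{\partial x}+\frac{\partial p}{\partial x}\frac{\partial}{\partial y}\right)\in W_2,$$ which is defined up to a nonzero constant factor. When $p$ is an irreducible polynomial generative function of $u$, the $\Bbbk[x,y]$-module $\mathcal{A}_{W_2}(u)$ is free of rank $1$ with generator $\delta_p$, so every element of $\mathcal{A}_{W_2}(u)$ has the form $f\delta_p$ with $f\in\Bbbk[x,y]$. A polynomial $f\in\Bbbk[x,y]$ is called $p$-free if $f$ is not divisible (in $\Bbbk[x,y]$) by any polynomial $r(p)$ with $r\in\Bbbk[t]$ of positive degree (in particular $f\ne0$). For every nonzero $g\in\Bbbk[x,y]$ there is a $p$-free polynomial $\bar g$ with $g=\bar g\cdot h(p)$ for some $h\in\Bbbk[t]$; it is unique up to a nonzero constant factor and is called the $p$-free polynomial corresponding to $g$. $\Bbbk[p]=\{r(p): r\in\Bbbk[t]\}$ and $\bar f\,\Bbbk[p]\,\delta_p=\{\bar f\, r(p)\,\delta_p : r\in\Bbbk[t]\}$. *)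

(* Defs.v *)
From HB Require Import structures.
From mathcomp Require Import all_boot all_order all_algebra all_field.
From mathcomp.multinomials Require Import mpoly.

Set Implicit Arguments.
Unset Strict Implicit.
Unset Printing Implicit Defensive.

Import GRing.Theory.
Local Open Scope ring_scope.

(* Subsets (of fields, of Lie algebras) are predicates into Prop. *)

Section RingNotions.

Definition divides (A : comNzRingType) (a b : A) : Prop := exists c, b = a * c.

Definition is_gcd (A : comNzRingType) (d a b : A) : Prop :=
  [/\ divides d a, divides d b &
      forall c, divides c a -> divides c b -> divides c d].

Definition irreducible_elt (A : idomainType) (p : A) : Prop :=
  [/\ p != 0, p \isn't a GRing.unit &
      forall a b, p = a * b -> a \is a GRing.unit \/ b \is a GRing.unit].

(* k-derivations of a k-algebra A with structure map [iota : k -> A]. *)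
Definition derivation (k A : comNzRingType) (iota : k -> A) (D : A -> A) : Prop :=
  [/\ forall a b, D (a + b) = D a + D b,
      forall c a, D (iota c * a) = iota c * D a &
      forall a b, D (a * b) = D a * b + a * D b].

End RingNotions.

Section Subfields.
Variables (k K : fieldType) (iota : k -> K).

Definition subfield (F : K -> Prop) : Prop :=
  [/\ forall c, F (iota c),
      forall a b, F a -> F b -> F (a - b),
      forall a b, F a -> F b -> F (a * b) &
      forall a, F a -> F a^-1].

(* k(t), the smallest subfield containing k and t. *)
Definition simple_ext (t : K) : K -> Prop :=
  fun z => forall F : K -> Prop, subfield F -> F t -> F z.

Definition algebraic_over (F : K -> Prop) (z : K) : Prop :=
  exists q : {poly K}, [/\ q != 0, forall i, F q`_i & root q z].

(* F has a transcendence basis over k with exactly one element, t. *)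
Definition trdeg_one (F : K -> Prop) : Prop :=
  exists t, [/\ F t, ~ algebraicOver iota t &
                forall z, F z -> algebraic_over (simple_ext t) z].

Definition maximal_trdeg_one_containing (u : K) (F : K -> Prop) : Prop :=
  [/\ subfield F, trdeg_one F, F u &
      forall G : K -> Prop, subfield G -> trdeg_one G -> G u ->
        (forall z, F z -> G z) -> forall z, G z -> F z].

Definition generative (u w : K) : Prop :=
  exists F : K -> Prop,
    maximal_trdeg_one_containing u F /\ forall z, F z <-> simple_ext w z.

End Subfields.

Section LieNotions.
(* Lie algebras of k-linear endomorphisms of A, with the commutator bracket. *)
Variables (k : comNzRingType) (A : comNzRingType) (iota : k -> A).
Implicit Types (D E : A -> A) (L S : (A -> A) -> Prop).

Definition bracket D E : A -> A := fun g => D (E g) - E (D g).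

Definition zero_op : A -> A := fun _ => 0.

Definition mul_op (f : A) D : A -> A := fun g => f * D g.

Definition lie_subalgebra L S : Prop :=
  [/\ forall D, S D -> L D,
      S zero_op,
      forall D E, S D -> S E -> S (fun g => D g + E g),
      forall c D, S D -> S (mul_op (iota c) D) &
      forall D E, S D -> S E -> S (bracket D E)].

Definition abelian_subalgebra L S : Prop :=
  lie_subalgebra L S /\ forall D E, S D -> S E -> bracket D E = zero_op.

Definition maximal_abelian_subalgebra L S : Prop :=
  abelian_subalgebra L S /\
  forall S', abelian_subalgebra L S' -> (forall D, S D -> S' D) ->
    forall D, S' D -> S D.

Definition centralizer L D : (A -> A) -> Prop :=
  fun E => L E /\ bracket D E = zero_op.

End LieNotions.

Section W2.
Variable k : closedFieldType.

(* k[x,y] and k(x,y) are {mpoly k[2]} and its fraction field; x and y have indices ord0 and ord_max in 'I_2. *)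

Definition constP (c : k) : {mpoly k[2]} := c%:MP.
Definition constK (c : k) : {fraction {mpoly k[2]}} := tofrac (constP c).

Definition dx (g : {mpoly k[2]}) : {mpoly k[2]} := mderiv ord0 g.
Definition dy (g : {mpoly k[2]}) : {mpoly k[2]} := mderiv ord_max g.

Definition W2 : (({mpoly k[2]} -> {mpoly k[2]}) -> Prop) := derivation constP.

(* D(u) = 0 is read through the extension of D to a derivation of k(x,y). *)
Definition annihilator (u : {fraction {mpoly k[2]}})
    (D : {mpoly k[2]} -> {mpoly k[2]}) : Prop :=
  W2 D /\
  exists D' : {fraction {mpoly k[2]}} -> {fraction {mpoly k[2]}},
    [/\ derivation constK D', forall g, D' (tofrac g) = tofrac (D g) & D' u = 0].

(* r(p) *)
Definition poly_at (r : {poly k}) (p : {mpoly k[2]}) : {mpoly k[2]} :=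
  (map_poly constP r).[p].

(* The gcd h is only determined up to a nonzero constant, hence a relation;
   a and b are the quotients of dp/dx and dp/dy by h. *)
Definition is_delta (p : {mpoly k[2]}) (delta : {mpoly k[2]} -> {mpoly k[2]}) : Prop :=
  exists h a b, [/\ is_gcd h (dx p) (dy p), dx p = h * a, dy p = h * b &
    delta = fun g => - b * dx g + a * dy g].

Definition p_free (p f : {mpoly k[2]}) : Prop :=
  forall r : {poly k}, (1 < size r)%N -> ~ divides (poly_at r p) f.

Definition corresponding_p_free (p g gbar : {mpoly k[2]}) : Prop :=
  p_free p gbar /\ exists r : {poly k}, g = gbar * poly_at r p.

(* f k[p] delta *)
Definition kp_line (f p : {mpoly k[2]}) (delta : {mpoly k[2]} -> {mpoly k[2]}) :
    (({mpoly k[2]} -> {mpoly k[2]}) -> Prop) :=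
  fun D => exists r : {poly k}, D = mul_op (f * poly_at r p) delta.

End W2.

(* Main.v *)
Require Import Defs.
From HB Require Import structures.
From mathcomp Require Import all_boot all_order all_algebra all_field.
From mathcomp.multinomials Require Import mpoly.
From mathcomp Require Import ring zify.
From Stdlib Require Import Classical_Prop PropExtensionality FunctionalExtensionality.

(** Every element of the annihilator of u has the form f delta_p, and
    [f delta_p, g delta_p] = (f delta_p(g) - g delta_p(f)) delta_p. Hence, for
    nonzero f, the two elements commute exactly when delta_p kills g / f, and
    the proof rests on identifying the kernel of delta_p on k(x,y) as k(p).

    That kernel is a subfield containing k(p), and k(p) is maximal among the
    subfields of transcendence degree one containing u, so it is enough that
    every z killed by delta_p is algebraic over k(p) ([kernel_algebraic]). Take
    w among x, y with delta_p(w) nonzero. Counting monomials gives a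
    nontrivial polynomial relation between p, w, z ([algebraic_relation]). In
    characteristic zero a derivation kills whatever is algebraic over its kernel
    ([derivation_algebraic]), so w is transcendental over the kernel and the
    relation already holds between p and z.

    If f = fbar t(p) with fbar p-free and g / f lies in k(p), then
    g s(p) = fbar r(p) for some r and some nonzero s; a Bezout relation in
    k[t] and p-freeness give that g lies in fbar k[p] ([p_free_ratio]). This is
    the statement about centralizers. In particular these centralizers are
    abelian, and the statement about maximal abelian subalgebras follows
    ([maximal_abelianP]).

    That the annihilator is generated by delta_p ([annihilatorP]) has two
    parts. A derivation killing u kills p, because p is algebraic over k(u).
    And D(p) = 0 forces (D(x), D(y)) to be a multiple of (- b, a), where
    (a, b) is the gradient of p divided by its gcd h; this uses that a divides
    e whenever a and b are coprime and a divides b e ([coprime_divides]), which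
    is proved in k[x][y] by Gauss's lemma. *)

Set Implicit Arguments.
Unset Strict Implicit.
Unset Printing Implicit Defensive.

Import GRing.Theory.
Local Open Scope ring_scope.

(** * Divisibility in k[x][y] *)

Definition coprime_elts (A : comUnitRingType) (a b : A) : Prop :=
  forall c, divides c a -> divides c b -> c \is a GRing.unit.

Lemma is_poly_unitE (A : idomainType) (q : {poly A}) :
  (q \is a GRing.unit) = (size q == 1) && (q`_0 \is a GRing.unit).
Proof. exact: poly_unitE. Qed.

Section Gauss.
Variable k : closedFieldType.
Implicit Types (c : k) (d : {poly k}) (a b e f g w : {poly {poly k}}).

Definition linear_factor c : {poly {poly k}} := ('X - c%:P)%:P.

Lemma linear_factor_neq0 c : linear_factor c != 0.
Proof. by rewrite polyC_eq0 polyXsubC_eq0. Qed.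

Lemma linear_factor_nunit c : linear_factor c \isn't a GRing.unit.
Proof.
apply/negP; rewrite is_poly_unitE => /andP[_]; rewrite coefC eqxx.
by rewrite is_poly_unitE size_XsubC.
Qed.

(** Divisibility by x - c is detected by specialising x to c, a morphism into
    the integral domain k[y]. *)
Lemma linear_factorP c f :
  divides (linear_factor c) f <-> map_poly (horner_eval c) f = 0.
Proof.
split=> [[q ->]|f0].
  by rewrite rmorphM /= map_polyC /= horner_evalE hornerXsubC subrr mul0r.
exists (\poly_(i < size f) (f`_i %/ ('X - c%:P))).
apply/polyP=> i; rewrite coefCM coef_poly.
have [lti|gei] := ltnP; last by rewrite mulr0 nth_default.
have : (map_poly (horner_eval c) f)`_i = 0 by rewrite f0 coef0.
rewrite coef_map /= horner_evalE => /eqP; rewrite -/(root _ _) -dvdp_XsubCl => dv.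
by rewrite mulrC divpK.
Qed.

Lemma linear_factor_prime c f g :
  divides (linear_factor c) (f * g) ->
  divides (linear_factor c) f \/ divides (linear_factor c) g.
Proof.
rewrite !linear_factorP rmorphM => /eqP /=; rewrite mulf_eq0.
by case/orP=> /eqP; [left | right].
Qed.

Definition primitive f := f != 0 /\ forall c, ~ divides (linear_factor c) f.

(** Every nonzero polynomial is a product of finitely many factors x - c and a
    polynomial without such a factor: the degree in x of the leading
    coefficient in y drops with each factor split off. *)
Lemma linear_factor_ind (P : {poly {poly k}} -> Prop) :
  (forall f, primitive f -> P f) ->
  (forall c f, f != 0 -> P f -> P (linear_factor c * f)) ->
  forall f, f != 0 -> P f.
Proof.
move=> Pprim Pstep f; have [n] := ubnP (size (lead_coef f)).
elim: n f => // n IHn f ltn f0.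
have [[c [g fE]]|nolin] :=
    classic (exists c, divides (linear_factor c) f); last first.
  by apply: Pprim; split=> // c divc; apply: nolin; exists c.
have g0 : g != 0 by apply: contraNneq f0 => g0; rewrite fE g0 mulr0.
rewrite fE; apply: Pstep => //; apply: IHn => //.
move: ltn; rewrite fE lead_coefM lead_coefC size_monicM ?monicXsubC ?lead_coef_eq0 //.
by rewrite size_XsubC.
Qed.

Lemma primitive_part g : g != 0 ->
  exists d h, [/\ d != 0, g = d%:P * h & primitive h].
Proof.
elim/linear_factor_ind => {g} [g prim|c g g0 [d [h [d0 -> prim]]]].
  by exists 1, g; rewrite oner_neq0 mul1r.
exists (('X - c%:P) * d), h; split=> //; first by rewrite mulf_neq0 ?polyXsubC_eq0.
by rewrite polyCM mulrA.
Qed.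

(** Gauss's lemma. Over an algebraically closed field the content d splits into
    linear factors, and each of them, being prime and not dividing the
    primitive polynomial a, divides the cofactor. *)
Lemma primitive_cancel d a e : d != 0 -> primitive a ->
  divides a (d%:P * e) -> divides a e.
Proof.
have [n] := ubnP (size d); elim: n d => // n IHn d ltn d0 prim [w dew].
have [sz1|sz1] := eqVneq (size d) 1.
  have /size_poly1P[x x0 dE] : size d == 1 by apply/eqP.
  exists ((x^-1)%:P%:P * w); rewrite mulrCA -dew dE mulrA -!polyCM.
  by rewrite mulVf // mul1r.
have /closed_rootP[c /factor_theorem[d' dE]] := sz1.
have d'0 : d' != 0 by apply: contraNneq d0 => d'0; rewrite dE d'0 mul0r.
have [|//|[w' wE]] := @linear_factor_prime c a w.
- by exists (d'%:P * e); rewrite -dew dE polyCM /linear_factor; ring.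
- by move=> diva; case: prim => _ /(_ c).
apply: (IHn d') => //.
  by move: ltn; rewrite dE size_Mmonic ?monicXsubC // size_XsubC addn2.
exists w'; apply: (mulfI (linear_factor_neq0 c)).
by rewrite [RHS]mulrCA -wE -dew dE polyCM /linear_factor; ring.
Qed.

(** The primitive part of the gcd over k(x) is, by Gauss's lemma, a common
    divisor in k[x][y]. *)
Lemma coprime_poly2_coprimep a b :
  (a != 0) || (b != 0) -> coprime_elts a b -> coprimep a b.
Proof.
move=> ab0 cop.
have g0 : gcdp a b != 0 by rewrite gcdp_eq0 negb_and.
have [d [h [d0 gE prim]]] := primitive_part g0.
have div_h f : gcdp a b %| f -> divides h f.
  case/Pdiv.Idomain.dvdpP=> [[c w] /= c0 cfE]; apply: (@primitive_cancel c) => //.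
  by exists (w * d%:P); rewrite mul_polyC cfE gE; ring.
have := cop h (div_h _ (dvdp_gcdl _ _)) (div_h _ (dvdp_gcdr _ _)).
rewrite is_poly_unitE => /andP[/eqP h1 _].
by rewrite coprimep_def gE size_Cmul ?h1.
Qed.

(** For primitive a, coprimality over k(x) yields the divisibility up to a
    content, which Gauss's lemma removes. A factor x - c of a is prime and does
    not divide b, so it divides e and can be cancelled. *)
Lemma coprime_divides_poly2 a b e :
  coprime_elts a b -> divides a (b * e) -> divides a e.
Proof.
have [-> cop|a0] := eqVneq a 0.
  case=> w; rewrite mul0r => be0; exists 0; rewrite mul0r.
  have ub : b \is a GRing.unit by apply: cop; [exists 0; rewrite mulr0|exists 1; rewrite mulr1].
  by apply: (mulrI ub); rewrite be0 mulr0.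
elim/linear_factor_ind: a0 b e => {a} [a prim|c a a0 IHa] b e cop.
- have [a0 _] := prim.
  case=> w beE; have copab : coprimep a b by apply: coprime_poly2_coprimep; rewrite ?a0.
  have : a %| e.
    rewrite -(Gauss_dvdpr e copab) beE; exact: dvdp_mulIl.
  case/Pdiv.Idomain.dvdpP=> [[d v] /= d0 deE]; apply: (@primitive_cancel d) => //.
  by exists v; rewrite mul_polyC deE mulrC.
case=> w beE; have [|divb|[e' eE]] := @linear_factor_prime c b e.
- by exists (a * w); rewrite beE; ring.
- case/negP: (linear_factor_nunit c); apply: cop => //; by exists a.
have [||v e'E] := IHa b e'.
- move=> h [h' hE] divb; apply: cop => //; exists (linear_factor c * h').
  by rewrite hE; ring.
- exists w; apply: (mulfI (linear_factor_neq0 c)).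
  by rewrite [LHS]mulrCA -eE beE mulrA.
by exists v; rewrite eE e'E mulrA.
Qed.

End Gauss.

(** * Polynomials in two variables *)

Section TwoVariables.
Variable k : closedFieldType.
Local Notation A2 := {mpoly k[2]}.
Local Notation X := ('X_(@ord0 1) : A2).
Local Notation Y := ('X_(@ord_max 1) : A2).

Lemma ord2P (i : 'I_2) : i = ord0 \/ i = ord_max.
Proof.
case: i => [[|[|//]] lti]; [left|right]; exact: val_inj.
Qed.

Lemma mpoly2_ind (P : A2 -> Prop) :
  (forall c, P c%:MP) -> P X -> P Y ->
  (forall f g, P f -> P g -> P (f + g)) ->
  (forall f g, P f -> P g -> P (f * g)) -> forall f, P f.
Proof.
move=> PC PX PY PD PM; elim/mpolyind => [|c m f _ _ Pf]; first by rewrite -mpolyC0.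
apply: (PD) => //; rewrite -mul_mpolyC; apply: (PM) => //.
rewrite mpolyXE_id big_ord_recl big_ord1.
have PXn g n : P g -> P (g ^+ n).
  move=> Pg; elim: n => [|n IHn]; first by rewrite expr0 -mpolyC1.
  by rewrite exprS; apply: (PM).
by apply: (PM); apply: PXn.
Qed.

Definition to_poly2 : A2 -> {poly {poly k}} :=
  mmap (polyC \o polyC) (fun i => if i == ord0 then 'X%:P else 'X).

Definition of_poly2 : {poly {poly k}} -> A2 :=
  horner_eval Y \o map_poly (horner_eval X \o map_poly (@mpolyC 2 k)).

HB.instance Definition _ := GRing.RMorphism.on to_poly2.
HB.instance Definition _ := GRing.RMorphism.on of_poly2.

Lemma to_poly2K : cancel to_poly2 of_poly2.
Proof.
elim/mpoly2_ind => [c|||f g fK gK|f g fK gK]; rewrite /to_poly2.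
- rewrite mmapC /of_poly2 /= map_polyC /= horner_evalE hornerC.
  by rewrite /= map_polyC horner_evalE hornerC.
- rewrite mmapX mmap1U eqxx /of_poly2 /= map_polyC /= horner_evalE hornerC.
  by rewrite /= map_polyX horner_evalE hornerX.
- by rewrite mmapX mmap1U /of_poly2 /= map_polyX horner_evalE hornerX.
- by rewrite !rmorphD /= -/to_poly2 fK gK.
- by rewrite !rmorphM /= -/to_poly2 fK gK.
Qed.

Lemma of_poly2K : cancel of_poly2 to_poly2.
Proof.
have XE : to_poly2 X = 'X%:P by rewrite /to_poly2 mmapX mmap1U eqxx.
have YE : to_poly2 Y = 'X by rewrite /to_poly2 mmapX mmap1U.
have KC d : to_poly2 (of_poly2 d%:P) = d%:P.
  rewrite /of_poly2 /= map_polyC horner_evalE hornerC /=.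
  elim/poly_ind: d => [|d c IHd]; first by rewrite !rmorph0.
  rewrite !rmorphD !rmorphM /= IHd map_polyX map_polyC /= !horner_evalE hornerX hornerC.
  by rewrite XE /to_poly2 mmapC.
elim/poly_ind => [|q d IHq]; first by rewrite !rmorph0.
rewrite !rmorphD !rmorphM /= IHq KC /of_poly2 /= map_polyX horner_evalE hornerX.
by rewrite YE.
Qed.

Lemma divides_morph (A B : comNzRingType) (f : {rmorphism A -> B}) a b :
  divides a b -> divides (f a) (f b).
Proof. by case=> c ->; exists (f c); rewrite rmorphM. Qed.

Lemma coprime_divides (a b e : A2) :
  coprime_elts a b -> divides a (b * e) -> divides a e.
Proof.
move=> cop div_abe; rewrite -[a]to_poly2K -[e]to_poly2K.
apply/divides_morph/(@coprime_divides_poly2 _ _ (to_poly2 b)).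
  move=> c ca cb; rewrite -[c]of_poly2K; apply/rmorph_unit/cop.
    by rewrite -[a]to_poly2K; apply: divides_morph.
  by rewrite -[b]to_poly2K; apply: divides_morph.
by rewrite -rmorphM; apply: divides_morph.
Qed.

(** Polynomials of degree less than d span a space of dimension at most
    d ^ 2. *)
Lemma mpoly2_dependent (I : finType) (v : I -> A2) d :
  (forall i, (msize (v i) <= d)%N) -> (d ^ 2 < #|I|)%N ->
  exists c : I -> k, (exists i, c i != 0) /\ \sum_i c i *: v i = 0.
Proof.
move=> szv ltI; pose J := ('I_d * 'I_d)%type.
pose mon (j : J) : 'X_{1..2} := [multinom if i == ord0 then j.1 : nat else j.2 : nat | i < 2].
pose M := \matrix_(i < #|I|, j < #|{: J}|) (v (enum_val i))@_(mon (enum_val j)).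
have /rowV0Pn[r /sub_kermxP rM r0] : kermx M != 0.
  rewrite -mxrank_eq0 mxrank_ker -lt0n subn_gt0.
  apply: leq_ltn_trans (rank_leq_col _) _.
  by rewrite card_prod !card_ord mulnn.
exists (fun i => r 0 (enum_rank i)); split.
  have /rV0Pn[j rj] := r0; exists (enum_val j).
  by rewrite enum_valK.
apply/mpolyP=> m; rewrite mcoeff0 raddf_sum /=.
have [ltm|gem] := ltnP (mdeg m) d; last first.
  apply: big1 => i _; rewrite mcoeffZ memN_msupp_eq0 ?mulr0 //.
  by apply: msize_mdeg_ge; apply: leq_trans gem.
have lem i : (m i < d)%N.
  apply: leq_ltn_trans ltm; rewrite mdegE (bigD1 i) //=; exact: leq_addr.
pose j : J := (Ordinal (lem ord0), Ordinal (lem ord_max)).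
have mE : mon j = m.
  by apply/mnmP=> i; rewrite mnmE; case: (ord2P i) => ->.
transitivity ((r *m M) 0 (enum_rank j)); last by rewrite rM mxE.
rewrite [RHS]mxE [RHS](reindex _ (onW_bij _ (@enum_rank_bij I))) /=.
by apply: eq_bigr => i _; rewrite mcoeffZ !mxE !enum_rankK mE.
Qed.
End TwoVariables.

(** * Derivations and algebraic elements *)

Section Derivations.
Variables (k A : comNzRingType) (iota : {rmorphism k -> A}).
Implicit Types D : A -> A.

Lemma derivation0 D : derivation iota D -> D 0 = 0.
Proof.
by case=> addD _ _; apply: (addrI (D 0)); rewrite -addD !addr0.
Qed.

Lemma derivation1 D : derivation iota D -> D 1 = 0.
Proof.
case=> _ _ mulD; apply: (addrI (D 1)).
by have := mulD 1 1; rewrite !mulr1 mul1r addr0.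
Qed.

Lemma derivation_const D c : derivation iota D -> D (iota c) = 0.
Proof.
move=> derD; have [_ scaleD _] := derD.
by rewrite -[iota c]mulr1 scaleD (derivation1 derD) mulr0.
Qed.

Lemma derivationN D a : derivation iota D -> D (- a) = - D a.
Proof.
move=> derD; have [_ scaleD _] := derD.
by rewrite -mulN1r -(rmorph1 iota) -rmorphN scaleD rmorphN rmorph1 mulN1r.
Qed.

Lemma derivation_horner D (q : {poly A}) z :
  derivation iota D -> (forall i, D q`_i = 0) -> D q.[z] = q^`().[z] * D z.
Proof.
move=> derD; have [addD _ mulD] := derD.
elim/poly_ind: q => [|q c IHq] kerq.
  by rewrite deriv0 !horner0 mul0r (derivation0 derD).
rewrite derivD derivM derivX derivC !hornerE addD mulD IHq; last first.
  by move=> i; have := kerq i.+1; rewrite coefD coefMX coefC addr0.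
have := kerq 0; rewrite coefD coefMX coefC add0r => ->.
by ring.
Qed.

End Derivations.

Section DerivationsField.
Variables (k K : fieldType) (iota : {rmorphism k -> K}).
Implicit Types E : K -> K.

Lemma derivationV E z : derivation iota E -> E z = 0 -> E z^-1 = 0.
Proof.
move=> derE Ez; have [-> | z0] := eqVneq z 0.
  by rewrite invr0 (derivation0 derE).
have [_ _ mulE] := derE; apply: (mulfI z0).
have := mulE z z^-1.
by rewrite mulfV // (derivation1 derE) Ez mul0r add0r mulr0 => <-.
Qed.

Lemma kernel_subfield E : derivation iota E -> subfield iota (fun z => E z = 0).
Proof.
move=> derE; have [addE _ mulE] := derE; split=> [c|a b Ea Eb|a b Ea Eb|a Ea].
- exact: derivation_const derE.
- by rewrite addE (derivationN _ derE) Ea Eb subrr.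
- by rewrite mulE Ea Eb mul0r mulr0 addr0.
- exact: derivationV derE Ea.
Qed.

Hypothesis char0 : [pchar K] =i pred0.

(** Applying E to q(z) = 0 gives q'(z) E(z) = 0. If E(z) is nonzero then z is
    a root of q', which is again a nonzero polynomial over the kernel, of smaller
    degree because the characteristic is zero; descent on the degree ends in a
    contradiction. *)
Lemma derivation_algebraic E (q : {poly K}) z :
  derivation iota E -> q != 0 -> (forall i, E q`_i = 0) -> root q z -> E z = 0.
Proof.
move=> derE; have [n] := ubnP (size q); elim: n q => // n IHn q ltn q0 kerq qz.
have := derivation_horner z derE kerq; rewrite (rootP qz) (derivation0 derE).
move=> /esym/eqP; rewrite mulf_eq0 => /orP[dqz | /eqP //].
have sz1 : (1 < size q)%N.
  rewrite ltnNge; apply: contraL qz => /size1_polyC qE.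
  by rewrite qE rootC -polyC_eq0 -qE.
have dq0 : q^`() != 0.
  apply/eqP => /polyP/(_ (size q).-2); rewrite coef_deriv coef0.
  have -> : (size q).-2.+1 = (size q).-1 by case: (size q) sz1 => [|[]].
  rewrite -mulr_natr => /eqP; rewrite mulf_eq0 -lead_coefE lead_coef_eq0 (negPf q0).
  rewrite (pcharf0P _).1 //; by case: (size q) sz1 => [|[]].
apply: (IHn q^`()) => //; first exact: leq_trans (lt_size_deriv q0) ltn.
have [addE _ _] := derE.
move=> i; rewrite coef_deriv; move: (kerq i.+1); move: (q`_i.+1) => a Ea.
elim: (i.+1) => [|m IHm]; first by rewrite mulr0n (derivation0 derE).
by rewrite mulrS addE Ea IHm addr0.
Qed.

End DerivationsField.


(** * The extension of a derivation to the field of fractions *)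

(** Here a, b, c, f are the derivatives of y d, z e, d, e. *)
Lemma quotient_rule_add (K : fieldType) (y z d e a b c f : K) :
  d != 0 -> e != 0 ->
  (a * e + y * d * f + (b * d + z * e * c) - (y + z) * (c * e + d * f)) / (d * e) =
  (a - y * c) / d + (b - z * f) / e.
Proof. by move=> d0 e0; field; rewrite d0 e0. Qed.

Lemma quotient_rule_mul (K : fieldType) (y z d e a b c f : K) :
  d != 0 -> e != 0 ->
  (a * (z * e) + y * d * b - y * z * (c * e + d * f)) / (d * e) =
  (a - y * c) / d * z + y * ((b - z * f) / e).
Proof. by move=> d0 e0; field; rewrite d0 e0. Qed.

Section FractionDerivation.
Variables (k : comNzRingType) (A : idomainType) (iota : {rmorphism k -> A}).
Local Notation K := {fraction A}.

Local Notation num z := (frac (repr (z : K))).1.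
Local Notation den z := (frac (repr (z : K))).2.

Lemma den_neq0 (z : K) : tofrac (den z) != 0.
Proof. by rewrite tofrac_eq0 denom_ratioP. Qed.

Lemma mul_den (z : K) : z * tofrac (den z) = tofrac (num z).
Proof.
rewrite -[z in LHS]reprK; unlock FracField.tofrac.
rewrite -[LHS]FracField.pi_mul; apply/eqmodP; rewrite /FracField.mulf /=.
rewrite FracField.equivfE !numden_Ratio ?oner_neq0 ?mulf_neq0 ?denom_ratioP ?oner_neq0 //.
by rewrite reprK !mulr1 mulrC.
Qed.

(** The quotient rule, solved for the derivative of z from the relation
    z * den z = num z. *)
Definition extend (D : A -> A) (z : K) : K :=
  (tofrac (D (num z)) - z * tofrac (D (den z))) / tofrac (den z).

Variable D : A -> A.
Hypothesis derD : derivation iota D.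

Lemma extendE (z : K) (n d : A) : d != 0 -> z * tofrac d = tofrac n ->
  extend D z = (tofrac (D n) - z * tofrac (D d)) / tofrac d.
Proof.
have [_ _ mulD] := derD.
rewrite /extend; move: (den_neq0 z) (mul_den z).
move: (num z) (den z) => n' d' d'0 zd'; rewrite -tofrac_eq0 => d0 zd.
have nd : n * d' = n' * d.
  by apply/eqP; rewrite -tofrac_eq !tofracM -zd -zd' mulrAC.
have := congr1 (fun a => tofrac (D a)) nd; rewrite /= !mulD !tofracD !tofracM -zd -zd' => eqD.
apply/eqP; rewrite eqr_div //; apply/eqP.
move/(canRL (addrK _)): eqD => eqD.
by rewrite [RHS]mulrBl eqD; ring.
Qed.

Lemma extend_tofrac g : extend D (tofrac g) = tofrac (D g).
Proof.
rewrite (@extendE _ g 1) ?oner_neq0 ?rmorph1 ?mulr1 ?divr1 //.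
by rewrite (derivation1 derD) rmorph0 mulr0 subr0.
Qed.

Lemma extend_derivation : derivation (fun c => tofrac (iota c)) (extend D).
Proof.
have [addD scaleD mulD] := derD.
split=> [y z|c z|y z].
- have ny := mul_den y; have nz := mul_den z.
  rewrite (@extendE _ (num y * den z + num z * den y) (den y * den z)); first last.
  + by rewrite !(tofracD, tofracM) -ny -nz; ring.
  + by rewrite mulf_neq0 ?denom_ratioP.
  rewrite addD !mulD !(tofracD, tofracM) -ny -nz /extend.
  exact: quotient_rule_add (den_neq0 y) (den_neq0 z).
- have nz := mul_den z.
  rewrite (@extendE _ (iota c * num z) (den z)) ?denom_ratioP //; last first.
    by rewrite tofracM -nz /= mulrA.
  by rewrite scaleD tofracM /extend mulrA mulrBr mulrA.
- have ny := mul_den y; have nz := mul_den z.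
  rewrite (@extendE _ (num y * num z) (den y * den z)); first last.
  + by rewrite !tofracM -ny -nz; ring.
  + by rewrite mulf_neq0 ?denom_ratioP.
  rewrite !mulD !(tofracD, tofracM) -ny -nz /extend.
  exact: quotient_rule_mul (den_neq0 y) (den_neq0 z).
Qed.

End FractionDerivation.

(** * Simple extensions *)

Section SimpleExtension.
Variables (k K : fieldType) (iota : {rmorphism k -> K}).
Implicit Types (r s : {poly k}) (u z : K).

Local Notation ev r z := (map_poly iota r).[z].

Lemma simple_ext_subfield u : subfield iota (simple_ext iota u).
Proof.
split=> [c F [FC _ _ _] _|y z Fy Fz F sF Fu|y z Fy Fz F sF Fu|y Fy F sF Fu].
- exact: FC.
- by have [_ FB _ _] := sF; apply: FB; [exact: Fy | exact: Fz].
- by have [_ _ FM _] := sF; apply: FM; [exact: Fy | exact: Fz].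
- by have [_ _ _ FV] := sF; apply: FV; exact: Fy.
Qed.

Lemma subfield_eval (F : K -> Prop) r u :
  subfield iota F -> F u -> F (ev r u).
Proof.
case=> FC FB FM _ Fu; have F0 : F 0 by rewrite -(rmorph0 iota); exact: FC.
have FD y z : F y -> F z -> F (y + z).
  by move=> Fy Fz; rewrite -[z]opprK; apply: (FB) => //; rewrite -sub0r; apply: FB.
elim/poly_ind: r => [|r c IHr]; first by rewrite rmorph0 horner0.
rewrite rmorphD rmorphM /= map_polyX map_polyC !hornerE.
by apply: (FD); [apply: FM | apply: FC].
Qed.

Lemma simple_ext_ratio u z : simple_ext iota u z ->
  exists r s, ev s u != 0 /\ z * ev s u = ev r u.
Proof.
move=> /(_ (fun y => exists r s, ev s u != 0 /\ y * ev s u = ev r u)).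
apply.
- split=> [c|y z' [r [s [s0 yE]]] [r' [s' [s'0 zE]]]|y z' [r [s [s0 yE]]] [r' [s' [s'0 zE]]]|y [r [s [s0 yE]]]].
  + by exists c%:P, 1; rewrite rmorph1 map_polyC !hornerC oner_neq0 mulr1.
  + exists (r * s' - r' * s), (s * s'); rewrite rmorphB !rmorphM /= !(hornerM, hornerD, hornerN).
    by rewrite mulf_neq0 // -yE -zE; split=> //; ring.
  + exists (r * r'), (s * s'); rewrite !rmorphM /= !hornerM.
    by rewrite mulf_neq0 // -yE -zE; split=> //; ring.
  + have [y0|y0] := eqVneq y 0.
      by exists 0, 1; rewrite rmorph0 rmorph1 y0 invr0 mul0r horner0 hornerC oner_neq0.
    by exists s, r; rewrite -yE mulf_neq0 // mulKf.
- by exists 'X, 1; rewrite rmorph1 map_polyX hornerC hornerX oner_neq0 mulr1.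
Qed.

End SimpleExtension.

(** * Partial derivatives, transcendence and algebraic relations *)

Section Transcendence.
Variable k : closedFieldType.
Local Notation A2 := {mpoly k[2]}.
Local Notation K := {fraction {mpoly k[2]}}.
Local Notation X := ('X_(@ord0 1) : A2).
Local Notation Y := ('X_(@ord_max 1) : A2).

HB.instance Definition _ := GRing.RMorphism.copy (@constP k) (@mpolyC 2 k).
HB.instance Definition _ :=
  GRing.RMorphism.copy (@constK k) (@FracField.tofrac A2 \o @constP k).

Implicit Types (r s : {poly k}) (a b f g p w : A2) (u z : K).

Local Notation evalK r z := (map_poly (@constK k) r).[z].

Lemma poly_atE r p : tofrac (poly_at r p) = evalK r (tofrac p).
Proof.
by rewrite /poly_at -horner_map -map_poly_comp.
Qed.

Lemma dx_derivation : derivation (@constP k) (@dx k).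
Proof. by split=> [f g|c f|f g]; [exact: mderivD|exact: mderiv_mulC|exact: mderivM]. Qed.

Lemma dy_derivation : derivation (@constP k) (@dy k).
Proof. by split=> [f g|c f|f g]; [exact: mderivD|exact: mderiv_mulC|exact: mderivM]. Qed.

Lemma combination_derivation a b :
  derivation (@constP k) (fun g => a * dx g + b * dy g).
Proof.
have [Dx Sx Mx] := dx_derivation; have [Dy Sy My] := dy_derivation.
split=> [f g|c f|f g]; rewrite ?(Dx, Sx, Mx) ?(Dy, Sy, My); ring.
Qed.

Lemma partialX : (dx X = 1) * (dy X = 0) * (dx Y = 0) * (dy Y = 1).
Proof.
rewrite /dx /dy !mderivX !mnm1E /=.
by rewrite !scale1r !scale0r -!mpolyX0; do !split=> //; congr 'X_[_];
   apply/mnmP=> i; rewrite mnmBE subnn mnm0E.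
Qed.

Lemma derivation_partials (D : A2 -> A2) : derivation (@constP k) D ->
  forall g, D g = D X * dx g + D Y * dy g.
Proof.
move=> derD; have [addD _ mulD] := derD.
have [addE _ mulE] := combination_derivation (D X) (D Y).
elim/mpoly2_ind => [c|||f g fE gE|f g fE gE].
- by rewrite (derivation_const c derD) (derivation_const c dx_derivation)
             (derivation_const c dy_derivation) !mulr0 addr0.
- by rewrite !partialX mulr1 mulr0 addr0.
- by rewrite !partialX mulr1 mulr0 add0r.
- by rewrite addD fE gE addE.
- by rewrite mulD fE gE mulE.
Qed.

Hypothesis char0 : [pchar k] =i pred0.

Lemma char0K : [pchar K] =i pred0.
Proof. by move=> q; rewrite (fmorph_pchar (@constK k)). Qed.

Lemma partials_eq0 p : dx p = 0 -> dy p = 0 -> p = constP (p@_0).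
Proof.
move=> px py; apply/mpolyP=> m; rewrite mcoeffC.
have [<-|m0] := eqVneq; first by rewrite mulr1.
rewrite mulr0; have [i mi] : exists i, m i != 0%N.
  apply/existsP; apply: contraR m0; rewrite negb_exists => /forallP m0.
  by apply/eqP/mnmP=> i; rewrite mnm0E; apply/eqP; have:= m0 i; rewrite negbK.
have dp0 : p^`M(i) = 0 by case: (ord2P i) => ->.
have := congr1 (fun f => f@_(m - U_(i))) dp0; rewrite /= mcoeff_deriv mcoeff0.
rewrite submK ?lep1mP // => /eqP; rewrite -mulr_natr mulf_eq0 => /orP[/eqP //|].
by rewrite (pcharf0P _).1.
Qed.

(** An algebraic element is killed by every derivation over k, in particular by
    the two partial derivatives. *)
Lemma transcendental r p :
  (dx p != 0) || (dy p != 0) -> r != 0 -> evalK r (tofrac p) != 0.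
Proof.
move=> p_nconst r0; apply/negP=> rp0.
have kills D : derivation (@constP k) D -> D p = 0.
  move=> derD; apply/eqP; rewrite -tofrac_eq0 -(extend_tofrac derD).
  have derE : derivation (@constK k) (extend D) by exact: extend_derivation.
  apply/eqP; apply: (derivation_algebraic char0K derE _ _ rp0).
    by rewrite map_poly_eq0.
  by move=> i; rewrite coef_map; exact: derivation_const derE.
by move: p_nconst; rewrite (kills _ dx_derivation) (kills _ dy_derivation) eqxx.
Qed.

Lemma msize_mul_bound f g c d : (msize f <= c.+1)%N -> (msize g <= d.+1)%N ->
  (msize (f * g) <= (c + d).+1)%N.
Proof.
move=> szf szg; have [->|f0] := eqVneq f 0; first by rewrite mul0r msize0.
have [->|g0] := eqVneq g 0; first by rewrite mulr0 msize0.
by rewrite msizeM //; move: (msize f) (msize g) szf szg => m n; lia.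
Qed.

Lemma msize_exp_bound f c n : (msize f <= c.+1)%N -> (msize (f ^+ n) <= (n * c).+1)%N.
Proof.
move=> szf; elim: n => [|n IHn]; first by rewrite expr0 msize1.
by rewrite exprS mulSn; apply: msize_mul_bound.
Qed.

(** Three elements of k(x,y) are algebraically dependent. After clearing the
    denominator of z, the (N + 1) ^ 3 monomials of degree at most N in each of
    p, w, z become polynomials of degree at most 3 m N, where m bounds the
    degrees of the data; they live in a space of dimension O(N ^ 2), so they are
    linearly dependent once N is large. *)
Lemma algebraic_relation p w z : exists n (q : nat -> nat -> {poly k}),
  (exists j l, [/\ (j < n)%N, (l < n)%N & q j l != 0]) /\
  \sum_(j < n) (\sum_(l < n) evalK (q j l) (tofrac p) * z ^+ l) * tofrac w ^+ j = 0.
Proof.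
have d0 := den_neq0 z; have zE := mul_den z; move: d0 zE.
move: (_.1) (_.2) => num den den0 zE.
have [m [m0 mp mw mnum mden]] : exists m, [/\ (0 < m)%N, (msize p <= m)%N,
    (msize w <= m)%N, (msize num <= m)%N & (msize den <= m)%N].
  exists (msize p + msize w + msize num + msize den).+1.
  by move: (msize p) (msize w) (msize num) (msize den) => a b c d; split; lia.
(* (3 m (N + 1)) ^ 2 < (N + 1) ^ 3 *)
have [N NE] : exists N, N = (9 * m ^ 2)%N by eexists.
pose I := ('I_N.+1 * ('I_N.+1 * 'I_N.+1))%type.
pose v (t : I) := p ^+ t.2.2 * (w ^+ t.1 * (num ^+ t.2.1 * den ^+ (N - t.2.1))).
have szv t : (msize (v t) <= 3 * N.+1 * m)%N.
  case: t => j [l i]; rewrite /v /=.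
  have lti := ltn_ord i; have ltj := ltn_ord j; have ltl := ltn_ord l.
  have b f e : (msize f <= m)%N -> (msize (f ^+ e) <= (e * m).+1)%N.
    by move=> szf; apply/msize_exp_bound/leqW.
  have := msize_mul_bound (b p i mp) (msize_mul_bound (b w j mw)
     (msize_mul_bound (b num l mnum) (b den (N - l)%N mden))).
  move/leq_trans; apply; rewrite -!mulnDl.
  apply: (@leq_trans ((i + (j + (l + (N - l)))).+1 * m)).
    by rewrite mulSn -[_.+1]add1n leq_add2r.
  by rewrite leq_mul2r; apply/orP; right; lia.
have [|c [[[j0 [l0 i0]] c0] csum]] := mpoly2_dependent szv.
  rewrite !card_prod !card_ord (_ : _ ^ 2 = N * (N.+1 * N.+1))%N; last by rewrite NE; lia.
  by rewrite ltn_pmul2r.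
pose q j l := \poly_(i < N.+1) c (inord j, (inord l, inord i)).
exists N.+1, q; split.
  exists j0, l0; rewrite !ltn_ord; split=> //.
  apply/eqP => /polyP/(_ i0); rewrite coef_poly ltn_ord !inord_val coef0.
  exact/eqP.
have nz : tofrac den ^+ N != 0 by rewrite expf_neq0.
apply: (mulIf nz); rewrite mul0r.
transitivity (tofrac (\sum_t c t *: v t)); last by rewrite csum rmorph0.
have -> : tofrac (\sum_t c t *: v t) =
    \sum_j \sum_l \sum_i tofrac (c (j, (l, i)) *: v (j, (l, i))).
  under [RHS]eq_bigr => j _ do rewrite pair_bigA.
  by rewrite pair_bigA raddf_sum; apply: eq_bigr => -[j [l i]].
rewrite mulr_suml; apply: eq_bigr => j _.
rewrite !mulr_suml; apply: eq_bigr => l _.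
rewrite (@horner_coef_wide _ N.+1); last first.
  by rewrite (leq_trans (size_poly _ _)) ?size_poly.
rewrite !mulr_suml; apply: eq_bigr => i _.
rewrite coef_map coef_poly ltn_ord !inord_val -mul_mpolyC /v /=.
rewrite !tofracM !tofracXn -zE.
have ltl : (l <= N)%N by rewrite -ltnS.
have -> : tofrac den ^+ N = tofrac den ^+ l * tofrac den ^+ (N - l).
  by rewrite -exprD subnKC.
rewrite exprMn -/(constP _) -/(constK _).
move: (constK _) (tofrac p) (tofrac w) (tofrac den) => C P W D; ring.
Qed.

End Transcendence.

(** * The kernel of a derivation that kills p *)

Section KernelAndLines.
Variable k : closedFieldType.
Hypothesis char0 : [pchar k] =i pred0.
Local Notation A2 := {mpoly k[2]}.
Local Notation K := {fraction {mpoly k[2]}}.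
Local Notation X := ('X_(@ord0 1) : A2).
Local Notation Y := ('X_(@ord_max 1) : A2).
Local Notation evalK r z := (map_poly (@constK k) r).[z].
Implicit Types (r s : {poly k}) (a b f g h p w : A2) (u z : K).

Lemma not_algebraic p : (dx p != 0) || (dy p != 0) ->
  ~ algebraicOver (@constK k) (tofrac p).
Proof.
by move=> p_nconst [r r0 /rootP rp0]; have := transcendental char0 p_nconst r0; rewrite rp0 eqxx.
Qed.

(** In a polynomial relation between p, w and z, the coefficients of the powers
    of w lie in the kernel of E. Since E does not kill w, they all vanish
    by [derivation_algebraic]; one of them is then a nontrivial relation between
    p and z. *)
Lemma kernel_algebraic (E : K -> K) p w z :
  derivation (@constK k) E -> (dx p != 0) || (dy p != 0) ->
  E (tofrac p) = 0 -> E (tofrac w) <> 0 -> E z = 0 ->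
  algebraic_over (simple_ext (@constK k) (tofrac p)) z.
Proof.
move=> derE p_nconst Ep Ew Ez.
have kerF := kernel_subfield derE; have [E0 EB EM _] := kerF.
have [addE _ _] := derE.
have [n [q [[j [l [ltj ltl qjl]]] rel]]] := algebraic_relation p w z.
pose c j := \sum_(l < n) evalK (q j l) (tofrac p) * z ^+ l.
have kerc i : E (c i) = 0.
  apply: (big_ind (fun y => E y = 0)) => [|y y' Ey Ey'|m _]; first exact: derivation0 derE.
    by rewrite addE Ey Ey' addr0.
  rewrite EM //; first exact: (subfield_eval _ kerF).
  elim: (m : nat) => [|m' IHm]; first by rewrite expr0 (derivation1 derE).
  by rewrite exprS EM.
have P0 : \poly_(i < n) c i = 0.
  apply/eqP; apply/negPn/negP=> P0; apply: Ew.
  apply: (derivation_algebraic (char0K char0) derE P0).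
    move=> i; rewrite coef_poly; case: ifP => _; [exact: kerc | exact: derivation0 derE].
  by apply/rootP; rewrite horner_poly.
exists (\poly_(i < n) evalK (q j i) (tofrac p)); split.
- apply/eqP=> /polyP/(_ l); rewrite coef_poly ltl coef0; apply/eqP.
  exact: transcendental.
- have sF := simple_ext_subfield (@constK k) (tofrac p).
  move=> i; rewrite coef_poly; case: ifP => _; first exact: (subfield_eval _ sF).
  by have [F0 _ _ _] := sF; have := F0 0; rewrite rmorph0.
- apply/rootP; rewrite horner_poly.
  by have := congr1 (fun P : {poly K} => P`_j) P0; rewrite /= coef_poly ltj coef0.
Qed.

(** The kernel of E is a subfield of transcendence degree one containing k(p),
    so it equals k(p) by maximality. *)
Lemma kernel_generative (E : K -> K) u p w z :
  generative (@constK k) u (tofrac p) ->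
  derivation (@constK k) E -> (dx p != 0) || (dy p != 0) ->
  E (tofrac p) = 0 -> E (tofrac w) <> 0 -> E z = 0 ->
  simple_ext (@constK k) (tofrac p) z.
Proof.
move=> [F [[sF trF Fu maxF] FE]] derE p_nconst Ep Ew Ez.
have kerF := kernel_subfield derE.
have subF y : F y -> E y = 0 by move/FE => Fy; exact: (Fy (fun y' => E y' = 0)).
apply/FE/(maxF (fun y => E y = 0)) => //; last exact: subF.
exists (tofrac p); split=> // [|y Ey]; first exact: not_algebraic.
exact: (kernel_algebraic (w := w) derE).
Qed.

(** * p-free polynomials *)

Lemma poly_at_neq0 r p : (dx p != 0) || (dy p != 0) -> r != 0 -> poly_at r p != 0.
Proof. by move=> p_nconst r0; rewrite -tofrac_eq0 poly_atE transcendental. Qed.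

Lemma poly_atM r s p : poly_at (r * s) p = poly_at r p * poly_at s p.
Proof. by rewrite /poly_at rmorphM hornerM. Qed.

Lemma poly_atD r s p : poly_at (r + s) p = poly_at r p + poly_at s p.
Proof. by rewrite /poly_at rmorphD hornerD. Qed.

Lemma poly_atC (c : k) p : poly_at c%:P p = constP c.
Proof. by rewrite /poly_at map_polyC hornerC. Qed.

Lemma poly_at0 p : poly_at 0 p = 0.
Proof. by rewrite /poly_at rmorph0 horner0. Qed.

Lemma poly_at1 p : poly_at 1 p = 1.
Proof. by rewrite -polyC1 poly_atC rmorph1. Qed.

Lemma kernel_poly_at (D : A2 -> A2) r p :
  derivation (@constP k) D -> D p = 0 -> D (poly_at r p) = 0.
Proof.
move=> derD Dp; rewrite (derivation_horner _ derD) ?Dp ?mulr0 // => i.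
by rewrite coef_map; exact: derivation_const derD.
Qed.

(** Reduce r / s to lowest terms r1 / s1; a Bezout relation v r1 + w s1 = 1
    shows that s1(p) divides f, so that s1 is a constant. *)
Lemma p_free_ratio p f g r s : (dx p != 0) || (dy p != 0) -> p_free p f -> s != 0 ->
  g * poly_at s p = f * poly_at r p -> exists t, g = f * poly_at t p.
Proof.
move=> p_nconst free s0 eq_gf.
have d0 : gcdp r s != 0 by rewrite gcdp_eq0 negb_and s0 orbT.
have rE := divpK (dvdp_gcdl r s); have sE := divpK (dvdp_gcdr r s).
move: rE sE; set r1 := _ %/ _; set s1 := _ %/ _ => rE sE.
have cop : coprimep r1 s1 by apply: coprimep_div_gcd; rewrite s0 orbT.
have {}eq_gf : g * poly_at s1 p = f * poly_at r1 p.
  apply: (mulIf (poly_at_neq0 p_nconst d0)).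
  by rewrite -!mulrA -!poly_atM rE sE.
have [[v w] /= bez] := Bezout_eq1_coprimepP _ _ cop.
have s1_small : (size s1 <= 1)%N.
  rewrite leqNgt; apply/negP=> /free; apply.
  exists (poly_at v p * g + poly_at w p * f).
  rewrite mulrDr mulrCA [_ * g]mulrC eq_gf.
  transitivity (f * poly_at (v * r1 + w * s1) p); first by rewrite bez poly_at1 mulr1.
  by rewrite poly_atD !poly_atM; ring.
have s1E := size1_polyC s1_small; move: eq_gf; rewrite s1E poly_atC.
have c0 : s1`_0 != 0.
  by apply: contraNneq s0 => c0; rewrite -sE s1E c0 mul0r.
move=> eq_gf; exists ((s1`_0)^-1%:P * r1).
rewrite poly_atM poly_atC mulrCA -eq_gf mulrCA -rmorphM mulVf // rmorph1 mulr1 //.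
Qed.

Lemma poly_at_nconst r p : (dx p != 0) || (dy p != 0) -> (1 < size r)%N ->
  (1 < msize (poly_at r p))%N.
Proof.
move=> p_nconst; rewrite !ltnNge; apply: contra => /msize1_polyC rpE.
have : poly_at (r - ((poly_at r p)@_0)%:P) p == 0.
  by rewrite poly_atD -polyCN poly_atC rmorphN /= /constP -rpE subrr.
apply: contraLR => szr; apply: poly_at_neq0 => //.
by apply: contraNneq szr => /eqP; rewrite subr_eq0 => /eqP ->; rewrite size_polyC_leq1.
Qed.

Lemma msize_poly_at_mul r p g : (dx p != 0) || (dy p != 0) -> (1 < size r)%N ->
  g != 0 -> (msize g < msize (poly_at r p * g))%N.
Proof.
move=> p_nconst szr g0; have szrp := poly_at_nconst p_nconst szr.
have r0 : r != 0 by apply: contraTneq szr => ->; rewrite size_poly0.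
rewrite msizeM ?poly_at_neq0 //; move: (msize g) szrp (msize _) => m.
by move: (msize _) => n szn; lia.
Qed.

(** A unit has no nonconstant divisor, and r(p) is nonconstant when r is. *)
Lemma p_free1 p : (dx p != 0) || (dy p != 0) -> p_free p 1.
Proof.
move=> p_nconst r szr [c rc].
have c0 : c != 0 by apply: contra_eq_neq rc => ->; rewrite mulr0 oner_neq0.
have := msize_poly_at_mul p_nconst szr c0; rewrite -rc msize1 ltnS leqn0.
by rewrite msize_poly_eq0 (negPf c0).
Qed.

(** Splitting off factors r(p) lowers the degree. *)
Lemma p_free_exists p f : (dx p != 0) || (dy p != 0) -> f != 0 ->
  exists fbar, corresponding_p_free p f fbar.
Proof.
move=> p_nconst; have [n] := ubnP (msize f); elim: n f => // n IHn f ltn f0.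
have [free|nfree] := classic (p_free p f).
  by exists f; split=> //; exists 1; rewrite poly_at1 mulr1.
have [r [szr [g fE]]] : exists r, (1 < size r)%N /\ divides (poly_at r p) f.
  apply: NNPP => nex; apply: nfree => r szr div_f; apply: nex; by exists r.
have g0 : g != 0 by apply: contraNneq f0 => g0; rewrite fE g0 mulr0.
have [|fbar [free [s gE]]] := IHn g _ g0.
  move: ltn; rewrite fE ltnS; apply: leq_trans.
  exact: msize_poly_at_mul.
by exists fbar; split=> //; exists (s * r); rewrite fE gE poly_atM; ring.
Qed.

(** * The annihilator of u *)

Lemma coprime_gcd_quotients h a b : h != 0 -> is_gcd h (h * a) (h * b) ->
  coprime_elts a b.
Proof.
move=> h0 [_ _ hmax] c [a' aE] [b' bE].
have [||m hE] := hmax (h * c).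
- by exists a'; rewrite aE mulrA.
- by exists b'; rewrite bE mulrA.
apply/unitrPr; exists m; apply: (mulfI h0).
by rewrite mulrA -hE mulr1.
Qed.

Section Delta.
Variables (u : K) (p h a b : A2).
Hypotheses (u_nconst : forall c : k, u <> constK c).
Hypotheses (p_nconst : (dx p != 0) || (dy p != 0)).
Hypotheses (p_gen : generative (@constK k) u (tofrac p)).
Hypotheses (h_gcd : is_gcd h (dx p) (dy p)) (pxE : dx p = h * a) (pyE : dy p = h * b).

Let delta g := - b * dx g + a * dy g.

Lemma delta_derivation : derivation (@constP k) delta.
Proof. exact: combination_derivation. Qed.

Lemma h_neq0 : h != 0.
Proof.
by move: p_nconst; apply: contraTneq => h0; rewrite pxE pyE h0 !mul0r eqxx.
Qed.

Lemma delta_kills_p : delta p = 0.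
Proof. by rewrite /delta pxE pyE; ring. Qed.

Lemma delta_neq0 : exists w, delta w != 0.
Proof.
have [b0|b0] := eqVneq b 0; last first.
  by exists X; rewrite /delta !partialX mulr1 mulr0 addr0 oppr_eq0.
exists Y; rewrite /delta !partialX mulr1 mulr0 add0r.
by move: p_nconst; apply: contraTneq => a0; rewrite pxE pyE a0 b0 !mulr0 eqxx.
Qed.

(** Since u lies in k(p) outside k, writing u = r(p) / s(p) makes p a root of the
    nonzero polynomial r - u s over k(u), which E kills. *)
Lemma annihilates_p (E : K -> K) : derivation (@constK k) E -> E u = 0 ->
  E (tofrac p) = 0.
Proof.
move=> derE Eu; have [E0 EB EM _] := kernel_subfield derE.
have [F [[_ _ Fu _] FE]] := p_gen.
have [r [s [s0 us]]] := simple_ext_ratio ((FE u).1 Fu).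
pose R := map_poly (@constK k) r - u *: map_poly (@constK k) s.
have RE i : R`_i = constK r`_i - u * constK s`_i.
  by rewrite coefB coefZ !coef_map.
apply: (derivation_algebraic (char0K char0) derE (q := R)).
- apply: contraNneq s0 => R0.
  have [-> | s0] := eqVneq s 0; first by rewrite rmorph0 horner0.
  have /eqP := RE (size s).-1; rewrite R0 coef0 -lead_coefE eq_sym subr_eq0 => /eqP eq_us.
  case: (u_nconst (c := r`_(size s).-1 / lead_coef s)).
  rewrite fmorph_div; apply: (canRL (mulfK _)) => //.
  by rewrite fmorph_eq0 lead_coef_eq0.
- by move=> i; rewrite RE; exact: EB (E0 _) (EM _ _ Eu (E0 _)).
- by apply/rootP; rewrite /R hornerD hornerN hornerZ us subrr.
Qed.

(** D(p) = 0 reads D(x) a + D(y) b = 0, where dp/dx = h a and dp/dy = h b; as a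
    and b are coprime, the solutions are the multiples of (- b, a). *)
Lemma annihilatorP (D : A2 -> A2) :
  annihilator u D <-> exists g, D = mul_op g delta.
Proof.
split=> [[derD [E [derE ED Eu]]]|[g ->]].
- have Dp : D p = 0.
    by apply/eqP; rewrite -tofrac_eq0 -ED annihilates_p.
  have relD : a * D X = b * - D Y.
    apply: (mulfI h_neq0); apply/eqP; rewrite -subr_eq0 -Dp (derivation_partials derD p) pxE pyE.
    by apply/eqP; ring.
  have cop : coprime_elts a b.
    by apply: (coprime_gcd_quotients h_neq0); rewrite -pxE -pyE.
  have [g [DX DY]] : exists g, D X = - b * g /\ D Y = a * g.
    have [a0|a0] := eqVneq a 0.
      (* then b is a unit, dp/dx = 0 and D(y) = 0 *)
      have ub : b \is a GRing.unit.
        by apply: cop; [exists 0; rewrite a0 mulr0 | exists 1; rewrite mulr1].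
      exists (- (b^-1 * D X)); rewrite mulrNN mulVKr //; split=> //.
      move: relD; rewrite a0 !mul0r => /esym/eqP.
      rewrite mulf_eq0 oppr_eq0 => /orP[/eqP b0|/eqP//].
      by move: ub; rewrite b0 unitr0.
    have [|g gE] := coprime_divides cop (e := - D Y).
      by exists (D X).
    exists (- g); rewrite (mulrN a) -gE opprK; split=> //.
    by apply: (mulfI a0); rewrite relD gE; ring.
  exists g; apply: functional_extensionality => f.
  by rewrite (derivation_partials derD f) DX DY /mul_op /delta; ring.
- have derg : derivation (@constP k) (mul_op g delta).
    have -> : mul_op g delta = fun f => (g * - b) * dx f + (g * a) * dy f.
      by apply: functional_extensionality => f; rewrite /mul_op /delta; ring.
    exact: combination_derivation.
  split=> //; exists (extend (mul_op g delta)).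
  have derE : derivation (@constK k) (extend (mul_op g delta)) by exact: extend_derivation.
  split=> // [f|]; first exact: (extend_tofrac derg).
  have [F [[_ _ Fu _] FE]] := p_gen.
  apply: ((FE u).1 Fu _ (kernel_subfield derE)).
  by rewrite (extend_tofrac derg) /mul_op delta_kills_p mulr0 rmorph0.
Qed.

(** * Centralizers and maximal abelian subalgebras *)

Lemma bracket_mul_op f g :
  bracket (mul_op f delta) (mul_op g delta) =
  mul_op (f * delta g - g * delta f) delta.
Proof.
have [_ _ mulD] := delta_derivation.
by apply: functional_extensionality => w; rewrite /bracket /mul_op !mulD; ring.
Qed.

Lemma mul_op_eq0 f : mul_op f delta = @zero_op A2 -> f = 0.
Proof.
have [w dw] := delta_neq0; move=> /(congr1 (fun D => D w)) /eqP.
by rewrite /mul_op /zero_op mulf_eq0 (negPf dw) orbF => /eqP.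
Qed.

Lemma commuteP f g :
  bracket (mul_op f delta) (mul_op g delta) = @zero_op A2 <->
  f * delta g = g * delta f.
Proof.
rewrite bracket_mul_op; split=> [/mul_op_eq0/eqP|->]; first by rewrite subr_eq0 => /eqP.
by apply: functional_extensionality => w; rewrite /mul_op subrr mul0r.
Qed.

Lemma kp_line_commute f r s :
  bracket (mul_op (f * poly_at r p) delta) (mul_op (f * poly_at s p) delta) =
  @zero_op A2.
Proof.
have [_ _ mulD] := delta_derivation.
apply/commuteP; rewrite !mulD !(kernel_poly_at _ delta_derivation delta_kills_p).
ring.
Qed.

(** Commutation says that delta kills g / f, which therefore lies in k(p). *)
Lemma commute_ratio f g : f != 0 ->
  bracket (mul_op f delta) (mul_op g delta) = @zero_op A2 ->
  exists r s, s != 0 /\ g * poly_at s p = f * poly_at r p.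
Proof.
move=> f0 /commuteP eq_fg; pose E := extend delta.
have derE : derivation (@constK k) E := extend_derivation delta_derivation.
have Et := extend_tofrac delta_derivation.
have f0' : tofrac f != 0 by rewrite tofrac_eq0.
pose z := tofrac g / tofrac f.
have zf : z * tofrac f = tofrac g by rewrite divfK.
have Ez : E z = 0.
  rewrite /E (extendE delta_derivation f0 zf).
  suff -> : tofrac (delta g) = z * tofrac (delta f) by rewrite subrr mul0r.
  by apply: (mulfI f0'); rewrite mulrA [_ * z]mulrC zf -!tofracM eq_fg.
have [w dw] := delta_neq0.
have [||r [s [s0 zs]]] := simple_ext_ratio
  (kernel_generative (w := w) p_gen derE p_nconst _ _ Ez).
- by rewrite /E Et delta_kills_p rmorph0.
- by rewrite /E Et; apply/eqP; rewrite tofrac_eq0.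
exists r, s; split.
  by apply: contraNneq s0 => ->; rewrite rmorph0 horner0.
apply/eqP; rewrite -tofrac_eq !tofracM !poly_atE -zs -zf; apply/eqP; ring.
Qed.

Lemma centralizerP f fbar : f != 0 -> corresponding_p_free p f fbar ->
  forall D, centralizer (annihilator u) (mul_op f delta) D <-> kp_line fbar p delta D.
Proof.
move=> f0 [free [t fE]] D; split=> [[/annihilatorP[g ->]]|[r ->]].
- move=> /(commute_ratio f0)[r [s [s0]]].
  rewrite fE -mulrA -poly_atM => /(p_free_ratio p_nconst free s0)[t' ->].
  by exists t'.
- split; last by rewrite fE; exact: kp_line_commute.
  by apply/annihilatorP; exists (fbar * poly_at r p).
Qed.

Lemma kp_line_abelian f :
  abelian_subalgebra (@constP k) (annihilator u) (kp_line f p delta).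
Proof.
split=> [|D E [r ->] [s ->]]; last exact: kp_line_commute.
split=> [D [r ->]||D E [r ->] [s ->]|c D [r ->]|D E [r ->] [s ->]].
- by apply/annihilatorP; exists (f * poly_at r p).
- exists 0; apply: functional_extensionality => g.
  by rewrite /mul_op poly_at0 mulr0 mul0r.
- exists (r + s); apply: functional_extensionality => g.
  by rewrite /mul_op poly_atD; ring.
- exists (c%:P * r); apply: functional_extensionality => g.
  by rewrite /mul_op poly_atM poly_atC; ring.
- exists 0; rewrite kp_line_commute; apply: functional_extensionality => g.
  by rewrite /mul_op poly_at0 mulr0 mul0r.
Qed.

Lemma p_free_neq0 f : p_free p f -> f != 0.
Proof.
move=> free; apply/eqP => f0; apply: (free 'X); first by rewrite size_polyX.
by exists 0; rewrite mulr0.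
Qed.

(** A maximal abelian subalgebra is not zero, being otherwise strictly contained
    in k[p] delta. It is therefore contained in the centralizer of one of its nonzero
    elements, which is itself abelian. Conversely, an abelian subalgebra that
    contains fbar k[p] delta centralizes fbar delta. *)
Lemma maximal_abelianP S :
  maximal_abelian_subalgebra (@constP k) (annihilator u) S <->
  exists fbar, p_free p fbar /\ forall D, S D <-> kp_line fbar p delta D.
Proof.
split=> [[[[subS S0 SD SZ SB] comS] maxS]|[fbar [free SE]]].
- have [f [f0 Sf]] : exists f, f != 0 /\ S (mul_op f delta).
    apply: NNPP => none.
    have S_eq0 D : S D -> D = @zero_op A2.
      move=> SD'; have /annihilatorP[g DE] := subS _ SD'.
      have [g0|g0] := eqVneq g 0; last by case: none; exists g; rewrite -DE.
      by rewrite DE g0; apply: functional_extensionality => w; rewrite /mul_op mul0r.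
    have /S_eq0/mul_op_eq0/eqP : S (mul_op 1 delta).
      apply: (maxS _ (kp_line_abelian 1)) => [D /S_eq0 ->|].
        by have [[_ ? _ _ _] _] := kp_line_abelian 1.
      by exists 1; rewrite poly_at1 mulr1.
    by rewrite oner_eq0.
  have [fbar corr] := p_free_exists p_nconst f0.
  exists fbar; split=> [|D]; first by case: corr.
  have sub_line E : S E -> kp_line fbar p delta E.
    move=> SE; apply/(centralizerP f0 corr); split; first exact: subS.
    exact: comS.
  split; first exact: sub_line.
  exact: (maxS _ (kp_line_abelian fbar)).
- have fbar0 := p_free_neq0 free.
  have {SE} -> : S = kp_line fbar p delta.
    by apply: functional_extensionality => D; apply: propositional_extensionality.
  split=> [|S' [[subS' _ _ _ _] comS'] sub_line D S'D]; first exact: kp_line_abelian.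
  have Sfbar : S' (mul_op fbar delta).
    by apply: sub_line; exists 1; rewrite poly_at1 mulr1.
  have corr : corresponding_p_free p fbar fbar.
    by split=> //; exists 1; rewrite poly_at1 mulr1.
  apply/(centralizerP fbar0 corr); split; first exact: subS'.
  exact: comS'.
Qed.

End Delta.
End KernelAndLines.

(** * The theorem *)

Theorem theorem9 (k : closedFieldType) (char0 : [pchar k] =i pred0)
    (u : {fraction {mpoly k[2]}})
    (u_nonconst : forall c : k, u <> constK c)
    (u_polygen : exists q : {mpoly k[2]}, generative (@constK k) u (tofrac q))
    (p : {mpoly k[2]}) (p_irr : irreducible_elt p)
    (p_gen : generative (@constK k) u (tofrac p))
    (delta : {mpoly k[2]} -> {mpoly k[2]}) (delta_p : is_delta p delta) :
  (forall f : {mpoly k[2]}, f != 0 -> annihilator u (mul_op f delta) ->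
     forall fbar : {mpoly k[2]}, corresponding_p_free p f fbar ->
     forall D : {mpoly k[2]} -> {mpoly k[2]},
       centralizer (annihilator u) (mul_op f delta) D <-> kp_line fbar p delta D)
  /\
  (forall S : ({mpoly k[2]} -> {mpoly k[2]}) -> Prop,
     maximal_abelian_subalgebra (@constP k) (annihilator u) S <->
     exists fbar : {mpoly k[2]}, p_free p fbar /\
       forall D : {mpoly k[2]} -> {mpoly k[2]}, S D <-> kp_line fbar p delta D).
Proof.
have p_nconst : (dx p != 0) || (dy p != 0).
  rewrite -negb_and; apply/negP=> /andP[/eqP px /eqP py].
  have pE := partials_eq0 char0 px py; case: p_irr => p0 /negP p_nunit _.
  apply: p_nunit; rewrite pE; apply: (rmorph_unit (@constP k)).
  by rewrite unitfE; apply: contraNneq p0 => c0; rewrite pE c0 rmorph0.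
have [h [a [b [h_gcd pxE pyE ->]]]] := delta_p.
split=> [f f0 _ fbar corr|].
  exact: (centralizerP char0 u_nonconst p_nconst p_gen h_gcd pxE pyE f0 corr).
exact: (maximal_abelianP char0 u_nonconst p_nconst p_gen h_gcd pxE pyE).
Qed.
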